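(* Let $n\ge 3$ and let $D_n$ be the dihedral group. The saturated subsets of $D_n$ are: (a) if $n$ is odd: $\{e\}$ and $\{f,fr,\ldots,fr^{n-1}\}$; (b) if $n$ is even: the sets $\{e,r^k\}$ where $\frac{n}{\gcd(n,k)}$ is even; the sets $\{r^{2k},r^{2l}\}$ where $\frac{n}{\gcd(n,2k)}$ and $\frac{n}{\gcd(n,2l)}$ are even and $2$ appears with equal multiplicity in $2k$ and $2l$; and the three $n$-element sets $A\cup B$, $A\cup C$, $B\cup C$, where $A=\{r,r^3,\ldots,r^{n-1}\}$, $B=\{f,fr^2,\ldots,fr^{n-2}\}$, $C=\{fr,fr^3,\ldots,fr^{n-1}\}$.
   Context: For $n\ge3$, $D_n$ is the group of order $2n$ generated by $r,f$ with relations $r^n=f^2=e$ and $fr=r^{-1}f$; every element is uniquely $r^a$ or $fr^a$ with $a\in\mathbb{Z}/n\mathbb{Z}$. For a group $S$, a subset $U\subseteq S$ is avoidable if there is a partition $\{A',B'\}$ of $S$ such that no element of $U$ equals $xy$ with $x\neq y$ both in $A'$ or both in $B'$ (in either order). A subset is saturated if it is maximal with respect to inclusion among the avoidable subsets. *)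

(* Defs.v *)
From mathcomp Require Import all_boot fingroup.

Set Implicit Arguments.
Unset Strict Implicit.
Unset Printing Implicit Defensive.

Local Open Scope group_scope.

Section Avoidable.

Variables (gT : finGroupType) (S : {group gT}).
Implicit Types U X : {set gT}.

(* As (x, y) ranges over ordered pairs, both x * y and y * x are covered. *)
Definition avoids U X : bool :=
  [forall x in X, forall y in X, (x != y) ==> (x * y \notin U)].

(* In MathComp the blocks of a partition are nonempty and disjoint; the
   condition A' != B' ensures that there are two blocks. *)
Definition avoidable U : bool :=
  (U \subset S) &&
  [exists A' : {set gT}, exists B' : {set gT},
     [&& A' != B', partition [set A'; B'] S, avoids U A' & avoids U B']].

Definition saturated U : bool := maxset avoidable U.

End Avoidable.

Section Dihedral.

Variables (gT : finGroupType) (n : nat).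
Implicit Types (G : {group gT}) (r f : gT).

(* G is D_n (of order 2n), with its distinguished generators r and f. *)
Definition is_dihedral G r f : Prop :=
  [/\ #|G| = n.*2, <<[set r; f]>> = G :> {set gT}, r ^+ n = 1, f ^+ 2 = 1
    & f * r = r^-1 * f].

Definition reflections r f : {set gT} := [set f * r ^+ a | a : 'I_n].

Definition odd_rotations r : {set gT} :=
  [set r ^+ a | a : 'I_n & odd a].

Definition even_reflections r f : {set gT} :=
  [set f * r ^+ a | a : 'I_n & ~~ odd a].

Definition odd_reflections r f : {set gT} :=
  [set f * r ^+ a | a : 'I_n & odd a].

End Dihedral.

(* Main.v *)
Require Import Defs.
From mathcomp Require Import all_boot fingroup cyclic.

Set Implicit Arguments.
Unset Strict Implicit.
Unset Printing Implicit Defensive.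

Local Open Scope group_scope.

(**
U is avoidable iff the graph on G joining x <> y when x y or y x lies in U is
bipartite. Triangles show that an avoidable U cannot contain a reflection
together with 1 or a nontrivial even rotation, nor an odd rotation together
with reflections of both parities, nor three rotations u1, u2, u3 such that
u1 u2 / u3 is a square. On the reflections, f r^a is joined to f r^(a+m) for
each nontrivial r^m in U, so the absence of odd cycles there forces the 2-adic
valuations of all these m to be equal and smaller than that of n; in
particular n is even.

Conversely the large sets are (for n even) the complements of the three
subgroups of index 2, hence avoidable. For {r^k, r^l} the graph does not join
rotations to reflections: the reflections f r^a are coloured by the parity of
a / 2^v, v being the common valuation, and the rotations carry two matchings
x <-> x^-1 r^k and x <-> x^-1 r^l, whose union is bipartite.
*)

(** * Two-colouring a union of two matchings *)

(* Contract an edge x - s x: its ends become isolated and their neighbours t x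
   and t (s x) are joined by t instead; a colouring of the contracted graph
   extends back to x and s x. *)
Lemma involutions_coloring (T : finType) (s t : T -> T) :
    involutive s -> involutive t ->
  exists c : T -> bool,
    (forall x, s x != x -> c (s x) != c x) /\
    (forall x, t x != x -> c (t x) != c x).
Proof.
have [m] := ubnP #|[set x | s x != x]|.
elim: m s t => // m IHm s t les ss tt.
have [x /= sx|s_id] := pickP [pred x | s x != x]; last first.
  (* When [s] is the identity, each 2-cycle of [t] is coloured by comparing ranks. *)
  exists (fun x => (enum_rank x < enum_rank (t x))%N); split=> x.
    by rewrite -[s x != x]/([pred x | s x != x] x) s_id.
  move=> tx; rewrite tt ltnNge leq_eqVlt.
  have /negPf-> : (enum_rank x : nat) != enum_rank (t x).
    by rewrite (inj_eq val_inj) (inj_eq enum_rank_inj) eq_sym.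
  by case: (_ < _)%N.
pose P u := (u == x) || (u == s x).
have Ps u : P (s u) = P u by rewrite /P (inj_eq (inv_inj ss)) orbC -(inv_eq ss).
pose s' u := if P u then u else s u.
(* If only one of [t x] and [t (s x)] lies off the contracted edge, [t'] fixes it. *)
pose t' u := if P u then u else if P (t u) then
  (if P (t (s (t u))) then u else t (s (t u))) else t u.
have ss' : involutive s' by move=> u; rewrite /s'; case Pu: (P u); rewrite ?Pu ?Ps ?Pu.
have tt' : involutive t'.
  move=> u; rewrite /t'; case Pu: (P u); first by rewrite Pu.
  case Ptu: (P (t u)); last by rewrite Ptu tt Pu.
  by case Pv: (P (t _)); rewrite ?Pu ?Ptu ?Pv // tt Ps Ptu ss tt Pu.
have [|c [cs ct]] := IHm s' t' _ ss' tt'.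
  rewrite -ltnS; apply: leq_ltn_trans les; apply: proper_card; apply/properP; split.
    apply/subsetP=> u; rewrite !inE /s'; case: ifP => //; by rewrite eqxx.
  by exists x; rewrite !inE // /s' /P !eqxx.
(* [d] is chosen against the outer neighbour of [x]; failing that, so that [~~ d], the colour of
   [s x], differs from its outer neighbour; failing both, any value serves. If both neighbours
   exist, [t'] joins them, so the two demands agree. *)
pose d := if ~~ P (t x) then ~~ c (t x) else if ~~ P (t (s x)) then c (t (s x)) else true.
pose e u := if u == x then d else if u == s x then ~~ d else c u.
have eP u : ~~ P u -> e u = c u.
  by rewrite /P negb_or /e => /andP[/negPf-> /negPf->].
have ex : e x = d by rewrite /e eqxx.
have esx : e (s x) = ~~ d by rewrite /e (negPf sx) eqxx.
exists e; split=> u.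
  case Pu: (P u); last first.
    by move: (cs u); rewrite /s' Pu !eP ?Ps ?Pu.
  by case/orP: Pu => /eqP->; rewrite ?ss ex esx; case: (d).
have step v : P v -> ~~ P (t v) -> e (t v) != e v.
  move=> Pv Ptv; rewrite eP //; case/orP: Pv Ptv => /eqP->.
    by rewrite ex /d => ->; case: (c _).
  rewrite esx /d => Ptsx; rewrite Ptsx; case: ifP => [Ptx|_]; last by case: (c _).
  have Px : P x by rewrite /P eqxx.
  rewrite negbK; have := ct (t x).
  by rewrite /t' (negPf Ptx) tt Px (negPf Ptsx) (inj_eq (inv_inj tt)); apply.
move=> tu; case Pu: (P u); case Ptu: (P (t u)).
- case/orP: Pu Ptu tu => /eqP->; rewrite {1}/P => /orP[] /eqP->; rewrite ?eqxx // ex esx;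
   by case: (d).
- by apply: step; rewrite ?Pu ?Ptu.
- by rewrite eq_sym -{1}(tt u) step // ?Ptu // tt Pu.
by move: (ct u); rewrite /t' Pu Ptu !eP ?Pu ?Ptu //; apply.
Qed.

(** * Avoidability as two-colourability *)

Section Coloring.

Variables (gT : finGroupType) (G : {group gT}).
Implicit Types U V : {set gT}.

Definition separates U (c : gT -> bool) :=
  {in G &, forall x y, x != y -> c x = c y -> x * y \notin U}.

Lemma avoidable_sub U : avoidable G U -> U \subset G.
Proof. by case/andP. Qed.

Lemma avoidable_separates U : avoidable G U -> exists c, separates U c.
Proof.
case/andP=> _ /existsP[A /existsP[B /and4P[_ /and3P[/eqP cov _ _]]]].
have GE : G = A :|: B :> {set gT}.
  by rewrite -cov /cover bigcup_setU !big_set1.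
have avP X : avoids U X -> {in X &, forall x y, x != y -> x * y \notin U}.
  move=> avX x y xX yX xy.
  by move/forall_inP: avX => /(_ x xX)/forall_inP/(_ y yX)/implyP; apply.
move=> /avP avA /avP avB; exists (mem A) => x y.
rewrite GE !inE => xAB yAB xy /= eq_c.
have [xA|xA] := boolP (x \in A); first by apply: avA; rewrite // -eq_c.
by apply: avB; [move: xAB|move: yAB|]; rewrite -?eq_c ?(negPf xA).
Qed.

(** A colouring constant on [G] would give an empty block. Such a colouring separates [U] only if
    [U] contains no product of distinct elements of [G]; then every colouring does, and [pred1 1]
    has two nonempty classes. *)
Lemma separates_avoidable U c :
  (1 < #|G|)%N -> U \subset G -> separates U c -> avoidable G U.
Proof.
move=> G_gt1 sUG.
wlog [a [b [aG bG ca cb]]] : c / exists a b, [/\ a \in G, b \in G, c a & ~~ c b].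
  move=> IH sep.
  have const : {in G &, forall x y, c x = c y} -> avoidable G U.
    move=> cc; move: G_gt1; rewrite cardG_gt1 => /trivgPn[b bG b1].
    apply: (IH (pred1 1)); first by exists 1, b; rewrite group1 bG /= eqxx.
    by move=> x y xG yG xy _; apply: sep => //; apply: cc.
  have [/exists_inP[a aG ca]|/exists_inPn ca] := boolP [exists a in G, c a].
    have [/exists_inP[b bG cb]|/exists_inPn cb] := boolP [exists b in G, ~~ c b].
      by apply: (IH c) => //; exists a, b.
    apply: const => x y xG yG.
    by move: (cb x xG) (cb y yG); rewrite !negbK => -> ->.
  apply: const => x y xG yG.
  by move: (ca x xG) (ca y yG) => /negPf-> /negPf->.
move=> sep; rewrite /avoidable sUG /=.
pose A := [set x in G | c x]; pose B := [set x in G | ~~ c x].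
have aA : a \in A by rewrite inE aG.
have bB : b \in B by rewrite inE bG.
have AB : [disjoint A & B].
  by apply/pred0P=> x /=; rewrite !inE; case: (c x); rewrite ?andbF.
apply/existsP; exists A; apply/existsP; exists B; apply/and4P; split.
- by apply/eqP=> eqAB; move: aA; rewrite eqAB inE ca andbF.
- have -> : G = A :|: B :> {set gT}.
    by apply/setP=> x; rewrite !inE -andb_orr orbN andbT.
  apply: partitionU1 => //; last by apply/set0Pn; exists a.
  rewrite /partition /cover big_set1 eqxx inE eq_sym; apply/andP; split=> //.
  apply/andP; split; last by apply/set0Pn; exists b.
  by apply/trivIsetP=> X Y /set1P-> /set1P->; rewrite eqxx.
- apply/forall_inP=> x; rewrite inE => /andP[xG cx]; apply/forall_inP=> y.
  by rewrite inE => /andP[yG cy]; apply/implyP=> xy; apply: sep; rewrite ?cx.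
- apply/forall_inP=> x; rewrite inE => /andP[xG /negPf cx]; apply/forall_inP=> y.
  rewrite inE => /andP[yG /negPf cy]; apply/implyP=> xy.
  by apply: sep; rewrite ?cx.
Qed.

Lemma no_triangle U x y z : avoidable G U ->
    x \in G -> y \in G -> z \in G -> x != y -> x != z -> y != z ->
    (x * y \in U) || (y * x \in U) -> (x * z \in U) || (z * x \in U) ->
  (y * z \in U) || (z * y \in U) -> False.
Proof.
case/avoidable_separates=> c sep xG yG zG xy xz yz.
have edge u v : u \in G -> v \in G -> u != v ->
    (u * v \in U) || (v * u \in U) -> c u = ~~ c v.
  move=> uG vG uv; apply: contraTeq => /negPf cuv.
  have {cuv} cuv : c u = c v by move: cuv; case: (c u); case: (c v).
  by rewrite negb_or !sep // eq_sym.
move=> /(edge _ _ xG yG xy) cxy /(edge _ _ xG zG xz) cxz /(edge _ _ yG zG yz).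
by move: cxz; rewrite cxy; case: (c y); case: (c z).
Qed.

(** Both classifications go through this: an antichain of avoidable sets that dominates every
    avoidable set is exactly the family of maximal ones. *)
Lemma saturatedP (D : {set gT} -> Prop) U :
    (forall V, D V -> avoidable G V) ->
    (forall V, avoidable G V -> exists2 W, D W & V \subset W) ->
    (forall V W, D V -> D W -> V \subset W -> V = W) ->
  saturated G U <-> D U.
Proof.
move=> avD coverD antiD; split.
  case/maxsetP=> avU maxU; have [W DW sUW] := coverD _ avU.
  by rewrite -(maxU W) // avD.
move=> DU; apply/maxsetP; split=> [|V avV sUV]; first exact: avD.
have [W DW sVW] := coverD _ avV; apply/eqP; rewrite eqEsubset sUV andbT.
by rewrite (antiD U W) // (subset_trans sUV).
Qed.

End Coloring.

(** * Parity and 2-adic valuation *)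

(** The 2-adic valuation of the quotient is that of [n] minus the smaller of the two. The case
    [k = 0] stands apart because [logn 2 0 = 0] while the quotient is then 1. *)
Lemma even_div_gcdn n k : (0 < n)%N ->
  ~~ odd (n %/ gcdn n k) = (0 < k)%N && (logn 2 k < logn 2 n)%N.
Proof.
move=> n_gt0; case: (posnP k) => [->|k_gt0]; first by rewrite gcdn0 divnn n_gt0.
have q_gt0 : (0 < n %/ gcdn n k)%N.
  by rewrite divn_gt0 ?gcdn_gt0 ?n_gt0 // dvdn_leq ?dvdn_gcdl.
rewrite -dvdn2 -[2%N]/(2 ^ 1)%N pfactor_dvdn // logn_div ?dvdn_gcdl //.
by rewrite logn_gcd // subn_gt0 gtn_min ltnn.
Qed.

Lemma even_logn k : (0 < k)%N -> ~~ odd k = (0 < logn 2 k)%N.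
Proof. by move=> k_gt0; rewrite -dvdn2 -[2%N]/(2 ^ 1)%N pfactor_dvdn. Qed.

Lemma card_odd_ord m : #|[set a : 'I_m | odd a]| = m./2.
Proof.
rewrite -sum1_card (eq_bigl (fun a : 'I_m => odd a)) => [|a]; last by rewrite inE.
rewrite big_mkcond; elim: m => [|m IH]; first by rewrite big_ord0.
by rewrite big_ord_recr IH /= uphalf_half addnC; case: odd.
Qed.

(** * Structure and multiplication of the dihedral group *)

Section Dihedral.

Variables (gT : finGroupType) (G : {group gT}) (n : nat) (r f : gT).
Hypotheses (hn : (3 <= n)%N) (hG : is_dihedral n G r f).
Implicit Types U V : {set gT}.

Let n_gt0 : (0 < n)%N. Proof. exact: leq_trans hn. Qed.

(** [<[f]>] normalises [<[r]>], so [G] is their product. Since the orders of [f] and [r] are at most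
    2 and [n], the order [2n] of [G] forces equality and a trivial intersection. *)
Lemma dihedral_structure :
  [/\ #[r] = n, f \notin <[r]> & G = <[f]> * <[r]> :> {set gT}].
Proof.
case: hG => cardG genG rn f2 fr.
have rf : r^-1 ^ f = r by rewrite /conjg -fr mulKg.
have nrf : <[f]> \subset 'N(<[r]>).
  rewrite cycle_subG; apply/normP.
  by rewrite -(cycleV r) -cycleJ rf cycleV.
have GE : G = <[f]> * <[r]> :> {set gT}.
  by rewrite -genG (normC nrf) -(norm_joinEr nrf) joing_idl joing_idr.
have o_r : (#[r] %| n)%N by rewrite order_dvdn rn.
have o_f : (#[f] %| 2)%N by rewrite order_dvdn f2.
have := mul_cardG <[f]> <[r]>; rewrite -GE cardG.
move: (dvdn_leq n_gt0 o_r) (dvdn_leq (isT : (0 < 2)%N) o_f).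
rewrite -!/(#[_]) => le_r le_f card.
have tI_gt0 := cardG_gt0 (<[f]> :&: <[r]>)%G.
have le_rf : (#[f] * #[r] <= n.*2)%N by rewrite -mul2n leq_mul.
have tI : (#|<[f]> :&: <[r]>| = 1)%N.
  apply/eqP; rewrite eqn_leq tI_gt0 andbT -(@leq_pmul2l n.*2) ?double_gt0 //.
  by rewrite -card muln1.
have eq_rf : (#[f] * #[r] = 2 * n)%N by rewrite card tI muln1 mul2n.
have or_n : #[r] = n.
  apply/eqP; rewrite eqn_leq le_r -(@leq_pmul2l 2) // -eq_rf leq_mul2r le_f.
  by rewrite orbT.
split=> //; apply/negP => f_r.
have : f \in <[f]> :&: <[r]> by rewrite inE cycle_id.
move/card1_trivg: tI => ->; rewrite inE => /eqP f1.
move/eqP: eq_rf; rewrite f1 order1 or_n mul1n mul2n -addnn -{1}[n]addn0 eqn_add2l.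
by rewrite eq_sym -leqn0 leqNgt n_gt0.
Qed.

Let o_r : #[r] = n. Proof. by case: dihedral_structure. Qed.
Let r_in : r \in G.
Proof. by case: hG => _ <- _ _ _; rewrite mem_gen // !inE eqxx. Qed.
Let f_in : f \in G.
Proof. by case: hG => _ <- _ _ _; rewrite mem_gen // !inE eqxx orbT. Qed.
Let rX_in a : r ^+ a \in G. Proof. exact: groupX. Qed.

Lemma rot_eq a b : (r ^+ a == r ^+ b) = (a == b %[mod n]).
Proof. by rewrite eq_expg_mod_order o_r. Qed.

Lemma rot_neq_refl a b : (r ^+ a == f * r ^+ b) = false.
Proof.
have [_ /negP f_r _] := dihedral_structure; apply/eqP=> e; apply: f_r.
by rewrite -(mulgK (r ^+ b) f) -e groupM ?groupV ?mem_cycle.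
Qed.

Lemma dihedral_cases x : x \in G ->
  (exists a, x = r ^+ a) \/ (exists a, x = f * r ^+ a).
Proof.
have [_ _ ->] := dihedral_structure.
case/mulsgP=> _ _ /cycleP[i ->] /cycleP[a ->] ->; have [_ _ _ f2 _] := hG.
rewrite -[i]odd_double_half expgD -mul2n expgM f2 expg1n mulg1.
by case: (odd i); [right; exists a | left; exists a; rewrite mul1g].
Qed.

Lemma f_mulff : f * f = 1. Proof. by case: hG => _ _ _ <-. Qed.

Lemma rot_refl a x : r ^+ a * (f * x) = f * (r ^- a * x).
Proof.
have [_ _ _ _ fr] := hG.
have rf : r ^ f = r^-1 by rewrite -[in LHS](invgK r) conjVg /conjg -fr mulKg.
by rewrite !mulgA (conjgC (r ^+ a) f) conjXg rf expVgn.
Qed.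

Lemma refl_refl a y : f * r ^+ a * (f * y) = r ^- a * y.
Proof. by rewrite -mulgA rot_refl !mulgA f_mulff mul1g. Qed.

Lemma rot_sub u : u \in <[r]> -> u \in G.
Proof. by case/cycleP=> a ->. Qed.

Lemma rotC u v : u \in <[r]> -> v \in <[r]> -> u * v = v * u.
Proof. by move=> ur vr; apply: (centsP (cycle_abelian r)). Qed.

Lemma rot_f u x : u \in <[r]> -> u * (f * x) = f * (u^-1 * x).
Proof. by case/cycleP=> a ->; rewrite rot_refl. Qed.

Lemma rot_neq_f u v : u \in <[r]> -> v \in <[r]> -> u != f * v.
Proof. by case/cycleP=> a -> /cycleP[b ->]; rewrite rot_neq_refl. Qed.

Lemma rotV_rot a b : exists2 m, r ^- a * r ^+ b = r ^+ m & b = a + m %[mod n].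
Proof.
have [m e] : exists m, r ^- a * r ^+ b = r ^+ m.
  by apply/cycleP; rewrite groupM ?groupV ?mem_cycle.
by exists m => //; apply/eqP; rewrite -rot_eq expgD -e mulKVg.
Qed.

(** [p] colours rotations and [q] reflections, by exponent modulo [n]. The last four hypotheses
    treat the four kinds of products; a difference of exponents is encoded as [m], the second
    exponent being [a + m], to avoid subtraction in [nat]. *)
Lemma coloring_avoidable U (p q : nat -> bool) :
    U \subset G ->
    (forall a, p (a %% n) = p a) -> (forall a, q (a %% n) = q a) ->
    (forall a b, a != b %[mod n] -> p a = p b -> r ^+ (a + b) \notin U) ->
    (forall a m, ~~ (n %| m) -> q a = q (a + m)%N -> r ^+ m \notin U) ->
    (forall a m, p a = q (a + m)%N -> f * r ^+ m \notin U) ->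
    (forall a b, p a = q b -> f * r ^+ (a + b) \notin U) ->
  avoidable G U.
Proof.
move=> sUG pn qn rr ff_ rf fr.
pose c x := [exists a : 'I_n, (x == r ^+ a) && p a || (x == f * r ^+ a) && q a].
have cr a : c (r ^+ a) = p a.
  apply/existsP/idP => [[b]|pa].
    by rewrite rot_neq_refl orbF rot_eq => /andP[/eqP e]; rewrite -pn -e pn.
  exists (Ordinal (ltn_pmod a n_gt0)) => /=.
  by rewrite rot_eq modn_mod eqxx pn pa.
have cf a : c (f * r ^+ a) = q a.
  apply/existsP/idP => [[b]|qa].
    rewrite eq_sym rot_neq_refl (can_eq (mulKg f)) rot_eq => /andP[/eqP e].
    by rewrite -qn -e qn.
  exists (Ordinal (ltn_pmod a n_gt0)) => /=.
  by rewrite (can_eq (mulKg f)) rot_eq modn_mod eqxx qn qa orbT.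
have qmod a b : a = b %[mod n] -> q a = q b by move=> e; rewrite -qn e qn.
apply: (separates_avoidable (c := c)) => //.
  by have [-> _ _ _ _] := hG; rewrite -addnn -(addn1 1) leq_add // (leq_trans _ hn).
move=> x y /dihedral_cases[[a ->]|[a ->]] /dihedral_cases[[b ->]|[b ->]] xy;
  rewrite ?cr ?cf => cxy.
- by rewrite -expgD rr // -rot_eq.
- rewrite rot_refl; have [m -> /qmod e] := rotV_rot a b.
  by apply: (rf a); rewrite -e.
- by rewrite -mulgA -expgD addnC fr.
rewrite refl_refl; have [m -> e] := rotV_rot a b.
apply: (ff_ a); last by rewrite -(qmod _ _ e).
apply: contra xy => /dvdnP[k mE]; rewrite (can_eq (mulKg f)) rot_eq e mE.
by rewrite addnC modnMDl.
Qed.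

(** * Triangles and closed walks that restrict an avoidable set *)

Section Obstructions.

Variables (U : {set gT}) (avU : avoidable G U).

(** Triangle [r], [r^-1], [f w r], with products 1, [f w], [f w]; here [r != r^-1] because
    [n >= 3]. *)
Lemma one_refl w : 1 \in U -> w \in <[r]> -> f * w \in U -> False.
Proof.
move=> U1 wr Uw; have rr := cycle_id r.
apply: (@no_triangle _ G U r r^-1 (f * (w * r))) => //.
- by rewrite groupV.
- by rewrite !groupM // rot_sub.
- apply/eqP=> e; have : (r ^+ 2 == r ^+ 0) by rewrite expgS expg1 {1}e mulVg.
  by rewrite rot_eq !modn_small.
- by rewrite rot_neq_f ?groupM.
- by rewrite rot_neq_f ?groupV ?groupM.
- by rewrite mulgV U1.
- by rewrite rot_f // (rotC wr rr) mulKg Uw.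
- by rewrite -!mulgA mulgV mulg1 Uw orbT.
Qed.

(** Triangle [g], [f w g], [f w g^-1], with products [f w], [f w], [g^2]; it degenerates only when
    [g^2 = 1]. *)
Lemma square_refl g w :
  g \in <[r]> -> w \in <[r]> -> g ^+ 2 \in U -> f * w \in U -> g ^+ 2 = 1.
Proof.
move=> gr wr Ug Uw; apply/eqP; apply: contraT => g2.
case: (@no_triangle _ G U g (f * (w * g)) (f * (w * g^-1))) => //.
- exact: rot_sub.
- by rewrite !groupM // rot_sub.
- by rewrite !groupM ?groupV // rot_sub.
- by rewrite rot_neq_f ?groupM.
- by rewrite rot_neq_f ?groupM ?groupV.
- rewrite !(can_eq (mulKg _)); apply: contra g2 => /eqP gV.
  by rewrite expgS expg1 {1}gV mulVg.
- by rewrite rot_f // (rotC wr gr) mulKg Uw.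
- by rewrite -!mulgA mulVg mulg1 Uw orbT.
apply/orP; right; rewrite -mulgA rot_f ?groupM ?groupV // mulgA f_mulff mul1g.
by rewrite invMg invgK mulgA mulgKV -expg2.
Qed.

(** Triangle [g], [f w g], [g d^-1], with products [f w], [u], [f d w]. It will serve for [u] odd
    and reflections of opposite parities, where [u d] is a square. *)
Lemma refl_pair g u d w :
    g \in <[r]> -> d \in <[r]> -> w \in <[r]> -> g ^+ 2 = u * d ->
  u \in U -> f * w \in U -> f * (d * w) \in U -> d = 1.
Proof.
move=> gr dr wr g2 Uu Uw Udw; apply/eqP; apply: contraT => d1.
case: (@no_triangle _ G U g (f * (w * g)) (g * d^-1)) => //.
- exact: rot_sub.
- by rewrite !groupM // rot_sub.
- by rewrite groupM ?groupV ?rot_sub.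
- by rewrite rot_neq_f ?groupM.
- by rewrite -{1}[g]mulg1 (can_eq (mulKg g)) eq_sym eq_invg1.
- by rewrite eq_sym rot_neq_f ?groupM ?groupV.
- by rewrite rot_f // (rotC wr gr) mulKg Uw.
- by rewrite mulgA -expg2 g2 mulgK Uu.
apply/orP; right; rewrite rot_f ?groupM ?groupV // invMg invgK.
by rewrite (rotC wr gr) -mulgA mulKg.
Qed.

(** Triangle [g], [g^-1 u1], [g^-1 u2], with products [u1], [u2], [u3]; its vertices are distinct
    because the [ui] are. *)
Lemma three_rotations g u1 u2 u3 :
    g \in <[r]> -> u1 \in <[r]> -> u2 \in <[r]> -> u3 \in <[r]> ->
    u1 \in U -> u2 \in U -> u3 \in U -> u1 != u2 -> u1 != u3 -> u2 != u3 ->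
  g ^+ 2 * u3 = u1 * u2 -> False.
Proof.
move=> gr r1 r2 r3 U1 U2 U3 d12 d13 d23 e.
have gVr : g^-1 \in <[r]> by rewrite groupV.
apply: (@no_triangle _ G U g (g^-1 * u1) (g^-1 * u2)) => //.
- exact: rot_sub.
- by rewrite groupM // rot_sub.
- by rewrite groupM // rot_sub.
- apply: contra d23 => /eqP e1; apply/eqP; apply: (mulgI u1).
  by rewrite -e expgS expg1 {2}e1 mulKVg.
- apply: contra d13 => /eqP e2; apply/eqP; apply: (mulIg u2).
  by rewrite -e (rotC r3 r2) expgS expg1 {2}e2 mulKVg.
- by rewrite (can_eq (mulKg _)).
- by rewrite mulKVg U1.
- by rewrite mulKVg U2.
- suff -> : g^-1 * u1 * (g^-1 * u2) = u3 by rewrite U3.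
  apply: (mulgI (g ^+ 2)); rewrite e expgS expg1 -!mulgA mulKVg.
  by rewrite mulgA (rotC gr r1) -mulgA mulKVg.
Qed.

(** [c a] is the colour of [f r^a]. As [f r^a * f r^(a+m) = r^m], every step of length [m] flips the
    colour. *)
Lemma refl_walk : exists2 c : nat -> bool,
  (forall a b, a = b %[mod n] -> c a = c b) &
  (forall i m, r ^+ m \in U -> ~~ (n %| m) -> c (i * m)%N = c 0%N (+) odd i).
Proof.
have [c sep] := avoidable_separates avU; exists (fun a => c (f * r ^+ a)).
  by move=> a b /eqP; rewrite -rot_eq => /eqP->.
move=> i m Um nm; elim: i => [|i IH]; first by rewrite mul0n addbF.
rewrite mulSn /= addbN -IH; apply/eqP; apply: contraTT Um => ce.
suff -> : r ^+ m = f * r ^+ (i * m) * (f * r ^+ (m + i * m)).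
  apply: sep; rewrite ?groupM //.
    rewrite (can_eq (mulKg f)) rot_eq -{1}[(i * m)%N]add0n eqn_modDr mod0n eq_sym.
    exact: nm.
  by move: ce; case: (c _); case: (c _).
by rewrite refl_refl addnC expgD mulKg.
Qed.

(** The walk with steps [m] closes after [n / gcd(n, m)] steps, a number that must therefore be
    even. *)
Lemma even_rot m : r ^+ m \in U -> ~~ (n %| m) -> ~~ odd (n %/ gcdn n m).
Proof.
move=> Um nm; have [c cmod cw] := refl_walk.
have := cw (n %/ gcdn n m) m Um nm.
rewrite (cmod _ 0%N); first by case: odd => //; case: (c _).
apply/eqP; rewrite mod0n -/(dvdn _ _) mulnC muln_divA ?dvdn_gcdl // mulnC.
by rewrite -muln_divA ?dvdn_gcdr // dvdn_mulr.
Qed.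

(** Steps of length [k] and steps of length [l] both reach [lcm(k, l)], so [l / gcd(k, l)] and
    [k / gcd(k, l)] have the same parity. Unequal valuations would make exactly one of them even. *)
Lemma logn_rot k l : r ^+ k \in U -> ~~ (n %| k) ->
  r ^+ l \in U -> ~~ (n %| l) -> logn 2 k = logn 2 l.
Proof.
move=> Uk nk Ul nl; have [c _ cw] := refl_walk.
have pos m : ~~ (n %| m) -> (0 < m)%N by case: m => //; rewrite dvdn0.
have := cw (l %/ gcdn l k) k Uk nk.
have -> : (l %/ gcdn l k * k = k %/ gcdn k l * l)%N.
  by rewrite gcdnC ![(_ %/ _ * _)%N]mulnC !muln_divA ?dvdn_gcdl ?dvdn_gcdr // mulnC gcdnC.
rewrite cw // => /addbI/(congr1 negb); rewrite !even_div_gcdn ?pos //=.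
by case: ltngtP.
Qed.

End Obstructions.

(** * Membership and size of sets given by exponents *)

Lemma mem_rotations (P : pred nat) a : (forall b, P (b %% n)%N = P b) ->
  (r ^+ a \in [set r ^+ b | b : 'I_n & P b]) = P a.
Proof.
move=> Pn; apply/imsetP/idP => [[b Pb /eqP]|Pa].
  by move: Pb; rewrite inE rot_eq => Pb /eqP e; rewrite -Pn e Pn.
exists (Ordinal (ltn_pmod a n_gt0)); first by rewrite inE /= Pn.
by apply/eqP; rewrite rot_eq /= modn_mod.
Qed.

Lemma mem_reflections (P : pred nat) a : (forall b, P (b %% n)%N = P b) ->
  (f * r ^+ a \in [set f * r ^+ b | b : 'I_n & P b]) = P a.
Proof.
move=> Pn; rewrite -mem_rotations //; apply/imsetP/imsetP => -[b Pb e]; exists b => //.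
  exact: mulgI e.
by rewrite e.
Qed.

Lemma refl_notin_rotations (P : pred nat) a :
  (f * r ^+ a \in [set r ^+ b | b : 'I_n & P b]) = false.
Proof. by apply/imsetP=> -[b _ /esym/eqP]; rewrite rot_neq_refl. Qed.

Lemma rot_notin_reflections (P : pred nat) a :
  (r ^+ a \in [set f * r ^+ b | b : 'I_n & P b]) = false.
Proof. by apply/imsetP=> -[b _ /eqP]; rewrite rot_neq_refl. Qed.

Lemma card_rotations (P : pred nat) :
  #|[set r ^+ b | b : 'I_n & P b]| = #|[set b : 'I_n | P b]|.
Proof.
rewrite card_imset // => a b /eqP.
by rewrite rot_eq !modn_small // => /eqP/val_inj.
Qed.

Lemma card_reflections (P : pred nat) :
  #|[set f * r ^+ b | b : 'I_n & P b]| = #|[set b : 'I_n | P b]|.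
Proof.
rewrite card_imset // => a b /mulgI/eqP.
by rewrite rot_eq !modn_small // => /eqP/val_inj.
Qed.

Lemma subset_dihedral U V : U \subset G ->
    (forall a, r ^+ a \in U -> r ^+ a \in V) ->
    (forall a, f * r ^+ a \in U -> f * r ^+ a \in V) ->
  U \subset V.
Proof.
move=> /subsetP sUG rot refl; apply/subsetP=> x Ux.
by case: (dihedral_cases (sUG x Ux)) => -[a xE]; move: Ux; rewrite xE; auto.
Qed.

(** * Constructions of avoidable sets *)

(** No edge joins a rotation to a reflection. Among rotations the edges given by [u] are the pairs
    [x], [x^-1 u], which form a matching, so [involutions_coloring] colours them; [q] colours the
    reflections. *)
Lemma pair_avoidable (q : nat -> bool) k l :
    (forall a, q (a %% n) = q a) ->
    (forall a m, m \in [:: k; l] -> ~~ (n %| m) -> q (a + m)%N = ~~ q a) ->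
  avoidable G [set r ^+ k; r ^+ l].
Proof.
move=> qn qk.
(* Off [<[r]>] the map is the identity, which puts no constraint on the colouring. *)
pose s u x := if x \in <[r]> then x^-1 * u else x.
have sK u : u \in <[r]> -> involutive (s u).
  move=> ur x; rewrite /s; have [xr|xr] := boolP (x \in <[r]>); last first.
    by rewrite (negPf xr).
  by rewrite groupM ?groupV // invMg invgK (rotC _ xr) ?groupV // mulgKV.
have [c [ck cl]] := involutions_coloring (sK _ (mem_cycle r k)) (sK _ (mem_cycle r l)).
apply: (coloring_avoidable (p := fun a => c (r ^+ a)) (q := q)) => //.
- by apply/subsetP=> x /set2P[] ->.
- by move=> a; congr c; apply/eqP; rewrite rot_eq modn_mod.
- move=> a b ab cab.
  have edge m : r ^+ (a + m) = r ^+ (a + b) -> r ^+ m = r ^+ b.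
    by rewrite !expgD => /mulgI.
  have sE m : r ^+ (a + b) = r ^+ m -> s (r ^+ m) (r ^+ a) = r ^+ b.
    by move=> <-; rewrite /s mem_cycle expgD mulKg.
  apply/set2P=> -[] /sE e.
    by have := ck (r ^+ a); rewrite e rot_eq eq_sym ab cab eqxx => /(_ isT).
  by have := cl (r ^+ a); rewrite e rot_eq eq_sym ab cab eqxx => /(_ isT).
- move=> a m nm qam; apply/negP; rewrite !inE !rot_eq => kl.
  have [m' m'kl e] : exists2 m', m' \in [:: k; l] & m = m' %[mod n].
    by case/orP: kl => /eqP e; [exists k | exists l]; rewrite // !inE eqxx ?orbT.
  have nm' : ~~ (n %| m') by rewrite /dvdn -e.
  have := qk a m' m'kl nm'; rewrite -[q (a + m')%N]qn -modnDmr -e modnDmr qn -qam.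
  by case: (q a).
- by move=> a m _; rewrite !inE ![f * _ == _]eq_sym !rot_neq_refl.
by move=> a b _; rewrite !inE ![f * _ == _]eq_sym !rot_neq_refl.
Qed.

(** Adding an odd multiple of [2 ^ v] changes the parity of [a %/ 2 ^ v]; adding a multiple of [n]
    does not, since [2 ^ v.+1] divides [n]. *)
Lemma valuation_coloring v (q := fun a : nat => odd (a %/ 2 ^ v)) :
    (v < logn 2 n)%N ->
  (forall a, q (a %% n)%N = q a) /\
  (forall a m, (0 < m)%N -> logn 2 m = v -> q (a + m)%N = ~~ q a).
Proof.
move=> vn; have v_gt0 : (0 < 2 ^ v)%N by rewrite expn_gt0.
have qD a m : q (a + m * 2 ^ v)%N = q a (+) odd m.
  by rewrite /q addnC divnMDl // oddD addbC.
split=> [a|a m m_gt0 mv].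
  have /dvdnP[m nE] : (2 ^ v.+1 %| n)%N by rewrite pfactor_dvdn.
  rewrite [in RHS](divn_eq a n) [in RHS]addnC [X in (_ * X)%N]nE expnS !mulnA qD.
  by rewrite !oddM andbF addbF.
have [m' odd_m' ->] := pfactor_coprime (isT : prime 2) m_gt0.
by rewrite mv qD -coprime2n odd_m' addbT.
Qed.

(** Admitting [r ^+ k = 1] lets one lemma cover both families of pairs. *)
Lemma even_pair_avoidable k l :
    (n %| k) || ~~ odd (n %/ gcdn n k) -> ~~ odd (n %/ gcdn n l) ->
    (n %| k) || (logn 2 k == logn 2 l) ->
  avoidable G [set r ^+ k; r ^+ l].
Proof.
rewrite !even_div_gcdn // => vk /andP[l_gt0 vl] vkl.
have [qn qD] := valuation_coloring vl.
apply: pair_avoidable qn _ => a m; rewrite !inE => /orP[] /eqP-> nm; last exact: qD.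
move: vk vkl; rewrite (negPf nm) /= => /andP[k_gt0 _] /eqP e; exact: qD.
Qed.

(** Rotations get one colour, reflections the other; products within a class are rotations. *)
Lemma reflections_avoidable U :
  U \subset G -> (forall a, r ^+ a \notin U) -> avoidable G U.
Proof.
move=> sUG Ur.
by apply: (coloring_avoidable (p := xpredT) (q := xpred0)).
Qed.


(** * The set of all reflections, and the classification for odd [n] *)

Lemma rot_in_reflections a : (r ^+ a \in reflections n r f) = false.
Proof. by apply/imsetP=> -[b _ /eqP]; rewrite rot_neq_refl. Qed.

Lemma refl_in_reflections a : f * r ^+ a \in reflections n r f.
Proof.
apply/imsetP; exists (Ordinal (ltn_pmod a n_gt0)) => //.
by apply/eqP; rewrite (can_eq (mulKg f)) rot_eq /= modn_mod.
Qed.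

Lemma card_all_reflections : #|reflections n r f| = n.
Proof.
rewrite card_imset ?card_ord // => a b /mulgI/eqP.
by rewrite rot_eq !modn_small // => /eqP/val_inj.
Qed.

Lemma reflections_sub : reflections n r f \subset G.
Proof. by apply/subsetP=> _ /imsetP[a _ ->]; rewrite groupM. Qed.

Lemma rot_eq1 a : (r ^+ a == 1) = (n %| a).
Proof. by rewrite -order_dvdn o_r. Qed.

Lemma saturated_odd U : odd n ->
  saturated G U <-> U = [set 1] \/ U = reflections n r f.
Proof.
move=> odd_n; apply: (saturatedP (D := fun V => V = [set 1] \/ V = reflections n r f)).
- move=> V [->|->]; last first.
    by apply: reflections_avoidable reflections_sub _ => a; rewrite rot_in_reflections.
  (* The singleton is read as the pair [r^0], [r^0]; it contains no nontrivial rotation, so a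
     constant [q] suffices. *)
  rewrite -[[set 1]]setUid; apply: (@pair_avoidable xpred0 0 0) => // a m.
  by rewrite !inE orbb => /eqP->; rewrite dvdn0.
- move=> V avV; have sVG := avoidable_sub avV.
  (* [n / gcd(n, a)] divides the odd number [n], so [even_rot] leaves only the trivial rotation. *)
  have rot1 a : r ^+ a \in V -> r ^+ a = 1.
    move=> Va; apply/eqP; rewrite rot_eq1; apply: contraT => na.
    have := even_rot avV Va na; rewrite (dvdn_odd _ odd_n) //.
    by rewrite -[X in (_ %| X)](divnK (dvdn_gcdl n a)) dvdn_mulr.
  have [/exists_inP[x Vx x1]|/exists_inPn V1] := boolP [exists x in V, x \notin [set 1]].
    (* An element other than 1 must be a reflection, and [one_refl] then excludes 1. *)
    exists (reflections n r f); first by right.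
    apply: subset_dihedral => // a; last by rewrite refl_in_reflections.
    move=> /[dup] Va /rot1 a1; rewrite a1 in Va.
    case: (dihedral_cases (subsetP sVG x Vx)) => -[w xE]; rewrite xE in Vx x1.
      by rewrite (rot1 w) ?set11 in x1.
    by case: (one_refl avV Va (mem_cycle r w) Vx).
  by exists [set 1]; [left | apply/subsetP=> x /V1/negPn].
move=> V W [->|->] [->|->] //.
  by rewrite sub1set -(expg0 r) rot_in_reflections.
by move/subset_leq_card; rewrite cards1 card_all_reflections leqNgt (leq_trans _ hn).
Qed.

(** * The three large sets for even [n] *)

Section Even.

Hypothesis even_n : ~~ odd n.

Local Notation A := (odd_rotations n r).
Local Notation B := (even_reflections n r f).
Local Notation C := (odd_reflections n r f).

Let oddn b : odd (b %% n) = odd b.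
Proof. by apply: odd_mod; apply/negbTE. Qed.
Let evenn b : ~~ odd (b %% n) = ~~ odd b. Proof. by rewrite oddn. Qed.

Lemma mem_dihedral_parts a :
  (((r ^+ a \in A) = odd a) * ((r ^+ a \in B) = false) * ((r ^+ a \in C) = false) *
   (((f * r ^+ a)%g \in A) = false) * (((f * r ^+ a)%g \in B) = ~~ odd a) *
   (((f * r ^+ a)%g \in C) = odd a))%type.
Proof.
pose evn b := ~~ odd b; rewrite /odd_rotations /odd_reflections.
rewrite (mem_rotations _ oddn) (refl_notin_rotations odd).
rewrite (mem_reflections _ oddn) (rot_notin_reflections odd).
by rewrite (mem_reflections (P := evn) _ evenn) (rot_notin_reflections evn).
Qed.

Let mem := (in_setU, mem_dihedral_parts).

Lemma dihedral_parts_sub : [/\ A \subset G, B \subset G & C \subset G].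
Proof.
by split; apply/subsetP=> _ /imsetP[a _ ->]; rewrite ?groupM.
Qed.

Lemma card_dihedral_parts : [/\ #|A| = n./2, #|B| = n./2 & #|C| = n./2].
Proof.
rewrite card_rotations (card_reflections odd) card_odd_ord; split=> //.
rewrite (card_reflections (fun b => ~~ odd b)).
have := cardsC [set a : 'I_n | odd a]; rewrite card_odd_ord card_ord.
have -> : ~: [set a : 'I_n | odd a] = [set a : 'I_n | ~~ odd a].
  by apply/setP=> a; rewrite !inE.
by move=> e; apply: (@addnI n./2); rewrite e addnn even_halfK.
Qed.

Lemma card_dihedral_unions : [/\ #|A :|: B| = n, #|A :|: C| = n & #|B :|: C| = n].
Proof.
have [sAG sBG sCG] := dihedral_parts_sub.
have [cA cB cC] := card_dihedral_parts.
have union (X Y : {set gT}) : X \subset G -> #|X| = n./2 -> #|Y| = n./2 ->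
    (forall a, ~~ ((r ^+ a \in X) && (r ^+ a \in Y))) ->
    (forall a, ~~ ((f * r ^+ a \in X) && (f * r ^+ a \in Y))) -> #|X :|: Y| = n.
  move=> sXG cX cY rXY fXY; apply/eqP; rewrite -(even_halfK even_n) -addnn -{1}cX -cY.
  rewrite (leq_card_setU X Y).2; apply/pred0P => x /=; apply/negP => /andP[Xx Yx].
  case: (dihedral_cases (subsetP sXG x Xx)) => -[a xE]; rewrite xE in Xx Yx.
    by have := rXY a; rewrite Xx Yx.
  by have := fXY a; rewrite Xx Yx.
by split; apply: union => // a; rewrite !mem //; case: odd.
Qed.

(** Each set is the complement of a subgroup of index 2. The colour classes are the subgroup and its
    coset, and products within either class lie in the subgroup. *)
Lemma dihedral_unions_avoidable :
  [/\ avoidable G (A :|: B), avoidable G (A :|: C) & avoidable G (B :|: C)].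
Proof.
have [sAG sBG sCG] := dihedral_parts_sub.
split; last by apply: reflections_avoidable => [|a]; rewrite ?subUset ?sBG // !mem.
- apply: (coloring_avoidable (p := odd) (q := fun a => ~~ odd a)) => //.
  + by rewrite subUset sAG.
  + by move=> a b _ e; rewrite !mem oddD e addbb.
  + by move=> a m _; rewrite !mem oddD; case: odd; case: odd.
  + by move=> a m; rewrite !mem oddD; case: odd; case: odd.
  + by move=> a m; rewrite !mem oddD; case: odd; case: odd.
- apply: (coloring_avoidable (p := odd) (q := odd)) => //.
  + by rewrite subUset sAG.
  + by move=> a b _ e; rewrite !mem oddD e addbb.
  + by move=> a m _; rewrite !mem oddD; case: odd; case: odd.
  + by move=> a m; rewrite !mem oddD; case: odd; case: odd.
  + by move=> a m; rewrite !mem oddD; case: odd; case: odd.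
Qed.

(** * Classification for even [n] *)

(** The inequality in the second family excludes singletons, which are not maximal: [{r^(2k)}]
    extends to [{1, r^(2k)}]. The evenness conditions also rule out trivial rotations there. *)
Definition saturated_even_spec U : Prop :=
  [\/ exists2 k : nat, ~~ odd (n %/ gcdn n k) & U = [set 1; r ^+ k],
      exists k l : nat,
        [/\ ~~ odd (n %/ gcdn n (2 * k)%N),
            ~~ odd (n %/ gcdn n (2 * l)%N),
            logn 2 (2 * k)%N = logn 2 (2 * l)%N,
            r ^+ (2 * k)%N != r ^+ (2 * l)%N
          & U = [set r ^+ (2 * k)%N; r ^+ (2 * l)%N]]
    | [\/ U = A :|: B, U = A :|: C | U = B :|: C]].

Lemma avoidable_cover_refl U w : avoidable G U -> f * r ^+ w \in U ->
  exists2 V, saturated_even_spec V & U \subset V.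
Proof.
move=> avU Uw; have sUG := avoidable_sub avU.
(* An even rotation is a square, hence trivial by [square_refl], and [one_refl] forbids 1. *)
have odd_rot a : r ^+ a \in U -> odd a.
  move=> Ua; apply: contraT => /even_halfK aE; move: (Ua).
  rewrite -aE -mul2n mulnC expgM => Ua2.
  have a1 := square_refl avU (mem_cycle r _) (mem_cycle r w) Ua2 Uw.
  by rewrite a1 in Ua2; case: (one_refl avU Ua2 (mem_cycle r w) Uw).
have [/exists_inP[_ /imsetP[a odd_a ->] Ua]|/exists_inPn noA] :=
  boolP [exists x in A, x \in U]; last first.
  exists (B :|: C); first by constructor 3; constructor 3.
  apply: subset_dihedral => // a; rewrite !mem; last by case: odd.
  by move=> /[dup] Ua /odd_rot odd_a; have := noA (r ^+ a); rewrite !mem Ua => /(_ odd_a).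
have par b : f * r ^+ b \in U -> odd b = odd w.
  move=> Ub; apply/eqP; apply: contraT => bw.
  have /even_halfK gE : ~~ odd (a + b + w).
    move: odd_a bw; rewrite inE /= !oddD => ->; by case: odd; case: odd.
  have rr := mem_cycle r.
  have d1 : r ^+ b * r ^- w = 1.
    (* With [u = r^a] and [d = r^(b-w)], the product [u d] is the square of [r^((a+b+w)/2 - w)]; the
       half exists since [a] is odd and [b], [w] have opposite parities. *)
    apply: (@refl_pair U avU (r ^+ (a + b + w)./2 * r ^- w) (r ^+ a) _ (r ^+ w)) => //.
    - by rewrite groupM ?groupV.
    - by rewrite groupM ?groupV.
    - rewrite expgMn; last by apply: rotC; rewrite ?groupV.
      by rewrite -expgM muln2 gE !expgD expg2 -!mulgA mulKVg.
    - by rewrite mulgKV.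
  have : r ^+ b == r ^+ w by rewrite eq_mulgV1 d1.
  by rewrite rot_eq => /eqP e; rewrite -[odd b]oddn e oddn eqxx in bw.
case odd_w: (odd w) par => par.
  exists (A :|: C); first by constructor 3; constructor 2.
  by apply: subset_dihedral => // b; rewrite !mem; [move/odd_rot-> | move/par->].
exists (A :|: B); first by constructor 3; constructor 1.
by apply: subset_dihedral => // b; rewrite !mem; [move/odd_rot-> | move/par->].
Qed.


(** The even sum provides the root [g = r^((a+b+c)/2 - c)] required by [three_rotations]. *)
Lemma avoidable_three_rot U a b c : avoidable G U -> ~~ odd (a + b + c) ->
    r ^+ a \in U -> r ^+ b \in U -> r ^+ c \in U ->
  [|| r ^+ a == r ^+ b, r ^+ a == r ^+ c | r ^+ b == r ^+ c].
Proof.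
move=> avU /even_halfK hE Ua Ub Uc; apply: contraT; rewrite !negb_or => /and3P[ab ac bc].
have rX := mem_cycle r.
case: (@three_rotations U avU (r ^+ (a + b + c)./2 * r ^- c) _ _ _ _
  (rX a) (rX b) (rX c) Ua Ub Uc ab ac bc); first by rewrite groupM ?groupV.
rewrite expgMn; last by apply: rotC; rewrite ?groupV.
by rewrite -expgM muln2 hE !expgD expg2 -!mulgA mulVg mulg1 mulgV mulg1.
Qed.

Lemma odd_rot_eq U k l : avoidable G U -> r ^+ k \in U -> ~~ (n %| k) ->
  r ^+ l \in U -> ~~ (n %| l) -> odd k = odd l.
Proof.
move=> avU Uk nk Ul nl; apply: negb_inj.
have pos m : ~~ (n %| m) -> (0 < m)%N by case: m => //; rewrite dvdn0.
by rewrite (even_logn (pos k nk)) (even_logn (pos l nl)) (logn_rot avU Uk nk Ul nl).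
Qed.

(** Nontrivial rotations in [U] have exponents of equal valuation, hence of one parity. If [U]
    contains 1 or a nontrivial even rotation, [avoidable_three_rot] leaves at most two elements;
    otherwise [U] lies in [A]. *)
Lemma avoidable_cover_rot U : avoidable G U -> U \subset <[r]> ->
  exists2 V, saturated_even_spec V & U \subset V.
Proof.
move=> avU /subsetP Ur.
have [U1|U1] := boolP (1 \in U).
  have [/exists_inP[x Ux x1]|/exists_inPn all1] := boolP [exists x in U, x != 1].
    have /cycleP[k xE] := Ur x Ux; move: x1; rewrite xE rot_eq1 => nk.
    rewrite xE in Ux; exists [set 1; r ^+ k].
      by constructor 1; exists k; rewrite // (even_rot avU).
    apply/subsetP=> y Uy; rewrite !inE; apply: contraT.
    have /cycleP[l yE] := Ur y Uy; rewrite yE in Uy *.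
    rewrite negb_or rot_eq1 => /andP[nl kl].
    have := @avoidable_three_rot U 0 k l avU.
    rewrite oddD (odd_rot_eq avU Ux nk Uy nl) addbb => /(_ isT U1 Ux Uy).
    by rewrite ![r ^+ 0 == _]eq_sym !rot_eq1 (negPf nk) (negPf nl) eq_sym (negPf kl).
  (* Here [U] is just [{1}]; it extends by [r], for which the quotient is [n] itself. *)
  exists [set 1; r ^+ 1]; first by constructor 1; exists 1%N; rewrite // gcdn1 divn1.
  by apply/subsetP=> y /all1/negPn; rewrite !inE => ->.
have nU m : r ^+ m \in U -> ~~ (n %| m).
  by apply: contraL; rewrite -rot_eq1 => /eqP->.
have [/exists_inP[x Ux xA]|/exists_inPn allA] :=
  boolP [exists x in U, x \notin A]; last first.
  exists (A :|: B); first by constructor 3; constructor 1.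
  by apply/subsetP=> x /allA/negPn xA; rewrite inE xA.
have /cycleP[k xE] := Ur x Ux; rewrite {x}xE in Ux xA.
rewrite !mem in xA; have nk := nU k Ux; have kE := even_halfK xA.
have [/exists_inP[y Uy yx]|/exists_inPn allx] :=
  boolP [exists y in U, y != r ^+ k]; last first.
  exists [set 1; r ^+ k]; first by constructor 1; exists k; rewrite // (even_rot avU).
  by apply/subsetP=> y /allx/negPn; rewrite !inE orbC => ->.
have /cycleP[l yE] := Ur y Uy; rewrite {y}yE in Uy yx.
have nl := nU l Uy; have kl := odd_rot_eq avU Ux nk Uy nl.
have lE : (l./2).*2 = l by rewrite even_halfK // -kl.
exists [set r ^+ k; r ^+ l].
  constructor 2; exists k./2, l./2; rewrite !mul2n kE lE eq_sym.
  by rewrite !(even_rot avU) // (logn_rot avU Ux nk Uy nl).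
apply/subsetP=> z Uz; have /cycleP[m zE] := Ur z Uz; rewrite {z}zE in Uz *.
have km := odd_rot_eq avU Ux nk Uz (nU m Uz).
have := @avoidable_three_rot U k l m avU.
rewrite !oddD -km -kl (negPf xA) => /(_ isT Ux Uy Uz).
by rewrite !inE eq_sym (negPf yx) /= ![r ^+ m == _]eq_sym.
Qed.

(** This gives the antichain property: sizes separate the two types, and the even rotation in a pair
    keeps it out of the large sets. *)
Lemma saturated_even_spec_cases U : saturated_even_spec U ->
  (#|U| = 2 /\ exists2 a, ~~ odd a & r ^+ a \in U) \/
  (#|U| = n /\ forall a, r ^+ a \in U -> odd a).
Proof.
have [cAB cAC cBC] := card_dihedral_unions.
case=> [[k ek ->]|[k [l [_ _ _ kl ->]]]|[] ->].
- left; split; last by exists 0%N; rewrite // !inE eqxx.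
  rewrite cards2 eq_sym rot_eq1; case: (boolP (n %| k)) => // /gcdn_idPl nk.
  by rewrite nk divnn n_gt0 in ek.
- left; rewrite cards2 kl; split=> //; exists (2 * k)%N; rewrite ?mul2n ?odd_double //.
  by rewrite !inE eqxx.
all: by right; split=> // a; rewrite !mem ?orbF.
Qed.

Lemma saturated_even U : saturated G U <-> saturated_even_spec U.
Proof.
apply: saturatedP => [V|V avV|V W].
- have [avAB avAC avBC] := dihedral_unions_avoidable.
  case=> [[k ek ->]|[k [l [ek el kl _ ->]]]|[] -> //].
    by apply: (@even_pair_avoidable 0 k); rewrite ?dvdn0.
  by apply: even_pair_avoidable; rewrite // ?ek ?kl ?eqxx orbT.
- have [/exists_inP[x Vx xr]|/exists_inPn Vr] := boolP [exists x in V, x \notin <[r]>].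
    case: (dihedral_cases (subsetP (avoidable_sub avV) x Vx)) => -[w xE].
      by rewrite xE mem_cycle in xr.
    by rewrite xE in Vx; apply: avoidable_cover_refl Vx.
  by apply: avoidable_cover_rot => //; apply/subsetP=> x /Vr/negPn.
move=> /saturated_even_spec_cases DV /saturated_even_spec_cases DW sVW.
apply/eqP; rewrite eqEcard sVW /=.
(* The comparison [#|W| <= #|V|] fails only for a pair [V] and a large [W], the case left to the
   even rotation. *)
case: DV DW => -[cV hV] [] [cW hW]; rewrite cV cW //; last exact: ltnW.
by have [a ea /(subsetP sVW)/hW] := hV; rewrite (negPf ea).
Qed.

Lemma uniq_dihedral_unions : uniq [:: A :|: B; A :|: C; B :|: C].
Proof.
have neq (X Y : {set gT}) x : x \in X -> x \notin Y -> X != Y.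
  by move=> xX; apply: contraNneq => <-.
rewrite /= !inE negb_or !andbT -andbA; apply/and3P; split.
- by apply: (neq _ _ (f * r ^+ 0)); rewrite !mem.
- by apply: (neq _ _ (r ^+ 1)); rewrite !mem.
- by apply: (neq _ _ (r ^+ 1)); rewrite !mem.
Qed.

End Even.
End Dihedral.

Theorem theorem4p7 (gT : finGroupType) (G : {group gT}) (n : nat) (r f : gT)
    (hn : (3 <= n)%N) (hG : is_dihedral n G r f) :
  (odd n ->
     forall U : {set gT},
       saturated G U <-> U = [set 1] \/ U = reflections n r f)
  /\
  (~~ odd n ->
     let A := odd_rotations n r in
     let B := even_reflections n r f in
     let C := odd_reflections n r f in
     [/\ #|A :|: B| = n, #|A :|: C| = n, #|B :|: C| = n,
         uniq [:: A :|: B; A :|: C; B :|: C]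
       & forall U : {set gT},
           saturated G U <->
           [\/ exists2 k : nat, ~~ odd (n %/ gcdn n k) & U = [set 1; r ^+ k],
               exists k l : nat,
                 [/\ ~~ odd (n %/ gcdn n (2 * k)%N),
                     ~~ odd (n %/ gcdn n (2 * l)%N),
                     logn 2 (2 * k)%N = logn 2 (2 * l)%N,
                     r ^+ (2 * k)%N != r ^+ (2 * l)%N
                   & U = [set r ^+ (2 * k)%N; r ^+ (2 * l)%N]]
             | [\/ U = A :|: B, U = A :|: C | U = B :|: C]]]).
Proof.
split=> [odd_n U|even_n A B C]; first exact: saturated_odd hG U odd_n.
have [cAB cAC cBC] := card_dihedral_unions hn hG even_n.
split=> //; first exact: uniq_dihedral_unions hn hG even_n.
exact: saturated_even hn hG even_n.
Qed.
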